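(* Let $\underline{P}:\mathcal{D}_{LIN}\to\mathbb{R}$ be a conditional lower prevision. $\underline{P}$ is $2$-coherent on $\mathcal{D}_{LIN}$ if and only if the following axioms all hold: (A1) $\underline{P}(X|B)-\underline{P}(Y|B)\leq\sup\{X-Y|B\}$ for all $X|B,Y|B\in\mathcal{D}_{LIN}$; (A2) $\underline{P}(\lambda X|B)=\lambda\underline{P}(X|B)$ for all $X|B\in\mathcal{D}_{LIN}$ and all $\lambda\geq 0$; (A4) $\underline{P}(A(X-\underline{P}(X|A\wedge B))|B)=0$ for all $X\in\mathcal{X}$ and all $A,B\in\mathcal{B}^{\varnothing}$ with $A\wedge B\neq\varnothing$; (A6) $\underline{P}(\lambda X|B)\leq\lambda\underline{P}(X|B)$ for all $X|B\in\mathcal{D}_{LIN}$ and all $\lambda<0$.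
   Context: Fix a partition $\mathbb{P}$ of the sure event $\Omega$ into atoms $\omega$. A gamble is a bounded function $X:\mathbb{P}\to\mathbb{R}$. Events are subsets of $\mathbb{P}$, identified with their indicators; $\wedge,\vee,\neg$ denote intersection, union, complement; $\varnothing$ is the impossible event. For a gamble $X$ and an event $B\neq\varnothing$, the conditional gamble $X|B$ is the restriction of $X$ to $B$; thus $\sup\{X|B\}=\sup_{\omega\in B}X(\omega)$. A conditional lower prevision on a set $\mathcal{D}$ of conditional gambles is a map $\underline{P}:\mathcal{D}\to\mathbb{R}$. Let $\mathcal{X}$ be a linear space of gambles and $\mathcal{B}\subset\mathcal{X}$ a set of (indicators of) events in $\mathcal{X}$, with $\Omega\in\mathcal{B}$ and $BX\in\mathcal{X}$ for all $B\in\mathcal{B}$, $X\in\mathcal{X}$. Put $\mathcal{B}^{\varnothing}=\mathcal{B}\setminus\{\varnothing\}$ and $\mathcal{D}_{LIN}=\{X|B: X\in\mathcal{X}, B\in\mathcal{B}^{\varnothing}\}$. $\underline{P}$ is $2$-coherent on $\mathcal{D}$ iff for all $X_0|B_0,X_1|B_1\in\mathcal{D}$, all $s_1\geq 0$ and all $s_0\in\mathbb{R}$, setting $S(\underline{s})=\bigvee\{B_i:s_i\neq 0,\ i=0,1\}$ and $\underline{G}_2=s_1B_1(X_1-\underline{P}(X_1|B_1))-s_0B_0(X_0-\underline{P}(X_0|B_0))$, one has $\sup\{\underline{G}_2|S(\underline{s})\}\geq 0$ whenever $S(\underline{s})\neq\varnothing$. *)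

(* Defs.v *)
From HB Require Import structures.
From mathcomp Require Import all_boot all_order all_algebra.
From mathcomp Require Import all_classical all_reals all_analysis.

Set Implicit Arguments.
Unset Strict Implicit.
Unset Printing Implicit Defensive.

Import Order.TTheory GRing.Theory Num.Theory.
Import numFieldNormedType.Exports.

Local Open Scope classical_set_scope.
Local Open Scope ring_scope.

(* A conditional gamble is an event B with a function on B, so that X|B and
   Y|B are equal as soon as X and Y agree on B. *)
Definition cgamble (T : Type) (R : realType) : Type :=
  {B : set T & B -> R}.

Definition cond (T : Type) (R : realType) (X : T -> R) (B : set T) :
  cgamble T R := existT _ B (sigL B X).

Definition nonempty_events (T : Type) (EB : set (set T)) : set (set T) :=
  EB `\ set0.

Definition D_LIN (T : Type) (R : realType) (L : set (T -> R))
    (EB : set (set T)) : set (cgamble T R) :=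
  [set g | exists X B, [/\ L X, nonempty_events EB B & g = cond X B]].

(* Lower previsions on a set D of conditional gambles are represented by total
   functions, of which only the values on D are ever used. *)
Definition two_coherent (T : Type) (R : realType) (D : set (cgamble T R))
    (P : cgamble T R -> R) : Prop :=
  forall (X0 X1 : T -> R) (B0 B1 : set T),
    D (cond X0 B0) -> D (cond X1 B1) ->
  forall s0 s1 : R, 0 <= s1 ->
    let S := [set w | (s0 != 0 /\ B0 w) \/ (s1 != 0 /\ B1 w)] in
    let G w := s1 * \1_B1 w * (X1 w - P (cond X1 B1))
             - s0 * \1_B0 w * (X0 w - P (cond X0 B0)) in
    S !=set0 -> 0 <= sup (G @` S).

(* Main.v *)
Require Import Defs.
From HB Require Import structures.
From mathcomp Require Import all_boot all_order all_algebra.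
From mathcomp Require Import all_classical all_reals all_analysis.
From mathcomp Require Import ring lra.

(* If 2-coherence fails, then s1 U1 - s0 U0 <= -e < 0 on S, where
   Ui = Bi (Xi - P(Xi|Bi)) satisfies P(Ui|Bi) = 0.  Since B0 \/ B1 need not be
   an event of EB, the gambles cannot be compared conditionally on S; they are
   compared on B0 /\ B1 instead.  If Z <= -e on A outside C and P(Z|A) >= 0,
   then (A4) forces P(Z|A /\ C) >= 0, and dually; applied to s1 U1 and
   s0 U0 with A /\ C = B0 /\ B1, this contradicts (A1) on B0 /\ B1 when
   s0 > 0, and (A1) with (A6) when s0 < 0. *)

Set Implicit Arguments.
Unset Strict Implicit.
Unset Printing Implicit Defensive.

Import Order.TTheory GRing.Theory Num.Theory.
Import numFieldNormedType.Exports.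

Local Open Scope classical_set_scope.
Local Open Scope ring_scope.

(** * Conditional gambles and linear spaces of gambles *)

Lemma eq_cond (T : Type) (R : realType) (X Y : T -> R) (B : set T) :
  (forall w, B w -> X w = Y w) -> cond X B = cond Y B.
Proof.
move=> XY; congr existT; apply/eq_sigLP => w /set_mem; exact: XY.
Qed.

Lemma cond_inj (T : Type) (R : realType) (X Y : T -> R) (B C : set T) :
  cond X B = cond Y C -> B = C /\ forall w, B w -> X w = Y w.
Proof.
move=> XY; have BC : B = C by case: XY.
split=> // w Bw; subst C.
by have /eq_sigLP -> := existT_inj2 XY; rewrite ?mem_set.
Qed.

(** A conditional gamble records [X] only on [B], so [X] itself may lie outside [L]; what can be
    recovered is a representative in [L]. *)
Lemma D_LINP (T : Type) (R : realType) (L : set (T -> R)) (EB : set (set T))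
    (X : T -> R) (B : set T) :
  D_LIN L EB (cond X B) ->
  nonempty_events EB B /\ exists2 Y, L Y & forall w, B w -> X w = Y w.
Proof.
case=> Y [C [LY EC /cond_inj [BC XY]]]; subst C.
by split=> //; exists Y.
Qed.

Lemma D_LIN_cond (T : Type) (R : realType) (L : set (T -> R))
    (EB : set (set T)) (X : T -> R) (B : set T) :
  L X -> nonempty_events EB B -> D_LIN L EB (cond X B).
Proof. by move=> LX EB_B; exists X, B. Qed.

Lemma nonempty_eventsP (T : Type) (EB : set (set T)) (B : set T) :
  nonempty_events EB B <-> EB B /\ B !=set0.
Proof.
split=> -[EB_B B0]; split=> //; first exact/set0P/eqP.
by apply/eqP/set0P.
Qed.

Lemma submodZ (T : Type) (R : realType) (L : set (T -> R)) a X :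
  GRing.submod_closed (mem L) -> L X -> L (a *: X).
Proof.
move=> [L0 LS] LX; apply: set_mem; rewrite -[_ *: _]addr0.
by apply: LS => //; exact: mem_set.
Qed.

Lemma submodD (T : Type) (R : realType) (L : set (T -> R)) X Y :
  GRing.submod_closed (mem L) -> L X -> L Y -> L (X + Y).
Proof.
move=> [L0 LS] LX LY; apply: set_mem; rewrite -[X]scale1r.
by apply: LS; exact: mem_set.
Qed.

(** Serves the choices of stakes that make the gain constant: 2-coherence then becomes an inequality
    about that constant. *)
Lemma sup_ge0_cst (T : Type) (R : realType) (f : T -> R) (c : R) (A : set T) :
  A !=set0 -> (forall w, A w -> f w = c) -> 0 <= sup (f @` A) -> 0 <= c.
Proof.
move=> [w Aw] fc /le_trans; apply; apply: sup_le_ub; first by exists (f w), w.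
by move=> _ [v Av <-]; rewrite fc.
Qed.

Section coherence.
Context (T : Type) (R : realType) (L : set (T -> R)) (EB : set (set T)).
Hypothesis L_linear : GRing.submod_closed (mem L).
Hypothesis EB_sub : forall B, EB B -> L (\1_B).
Hypothesis EB_mul : forall B X, EB B -> L X -> L (\1_B \* X).
Hypothesis EB_cap :
  forall A B, EB A -> EB B -> A `&` B !=set0 -> EB (A `&` B).
Variable P : cgamble T R -> R.
Local Notation D := (D_LIN L EB).
Local Notation gain X B c := (\1_B \* (X \- cst c)).

Lemma gain_mem (X : T -> R) (B : set T) (c : R) :
  EB B -> L X -> L (gain X B c).
Proof.
move=> EB_B LX.
have -> : gain X B c = \1_B \* X + (- c) *: (\1_B : T -> R).
  apply/funext => w.
  rewrite (_ : (_ + _) w = \1_B w * X w + (- c) * \1_B w) //=; ring.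
by apply: submodD => //; [exact: EB_mul|apply: submodZ => //; exact: EB_sub].
Qed.

(** * Necessity: the axioms follow from 2-coherence *)

Section necessity.
Hypothesis coh : two_coherent D P.

(** With both stakes equal to 1, the gain on [B] is [X - Y] minus the difference of the previsions.
    The assumption [has_sup] excludes the default value 0 of [sup]. *)
Lemma coherent_le_sup (X Y : T -> R) (B : set T) : B !=set0 ->
  D (cond X B) -> D (cond Y B) -> has_sup ((X \- Y) @` B) ->
  P (cond X B) - P (cond Y B) <= sup ((X \- Y) @` B).
Proof.
move=> [b Bb] DX DY supXY.
have := @coh _ _ _ _ DY DX 1 1 ler01.
set S := [set _ | _]; set G := fun _ => _ => /= GS.
have {GS} : 0 <= sup (G @` S) by apply: GS; exists b; left; rewrite oner_neq0.
have SB w : S w -> B w by case=> -[].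
suff : sup (G @` S) <= sup ((X \- Y) @` B) - (P (cond X B) - P (cond Y B)).
  lra.
apply: sup_le_ub.
  by exists (G b), b => //; left; rewrite oner_neq0.
move=> _ [w /SB Bw <-]; rewrite /G indicE mem_set //=.
have : (X \- Y) w <= sup ((X \- Y) @` B).
  by apply: ub_le_sup; [case: supXY|exists w].
rewrite /=; lra.
Qed.

(** Stakes 1 on [l *: X] and [l] on [X] leave a constant gain. Here [l] is the stake [s0], of
    arbitrary sign, so this yields both (A6) and one half of (A2). *)
Lemma coherent_scale_le (X : T -> R) (B : set T) (l : R) : B !=set0 ->
  D (cond X B) -> D (cond (l *: X) B) ->
  P (cond (l *: X) B) <= l * P (cond X B).
Proof.
move=> [b Bb] DX DlX; rewrite -subr_ge0.
have := @coh _ _ _ _ DX DlX l 1 ler01.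
set S := [set _ | _]; set G := fun _ => _ => /= GS.
have S0 : S !=set0 by exists b; right; rewrite oner_neq0.
apply: (sup_ge0_cst S0 _ (GS S0)) => w Sw.
have Bw : B w by case: Sw => -[].
rewrite /G indicE mem_set //= (_ : (l *: X) w = l * X w) //; ring.
Qed.

(** The same bets with exchanged roles: [l] is now the stake [s1], hence the sign condition. *)
Lemma coherent_scale_ge (X : T -> R) (B : set T) (l : R) : B !=set0 ->
  D (cond X B) -> D (cond (l *: X) B) -> 0 <= l ->
  l * P (cond X B) <= P (cond (l *: X) B).
Proof.
move=> [b Bb] DX DlX l0; rewrite -subr_ge0.
have := @coh _ _ _ _ DlX DX 1 l l0.
set S := [set _ | _]; set G := fun _ => _ => /= GS.
have S0 : S !=set0 by exists b; left; rewrite oner_neq0.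
apply: (sup_ge0_cst S0 _ (GS S0)) => w Sw.
have Bw : B w by case: Sw => -[].
rewrite /G indicE mem_set //= (_ : (l *: X) w = l * X w) //; ring.
Qed.

(** On [B] the bet on [X] given [A /\ B] has the same gain as the gamble conditioned on [B]. Unit
    stakes cancel the two and leave only the prevision, with a sign that depends on the order of the
    bets. *)
Lemma coherent_gain0 (X : T -> R) (A B : set T) : B !=set0 ->
  D (cond X (A `&` B)) -> D (cond (gain X A (P (cond X (A `&` B)))) B) ->
  P (cond (gain X A (P (cond X (A `&` B)))) B) = 0.
Proof.
move=> [b Bb] DX DZ; apply/eqP; rewrite eq_le -oppr_ge0; apply/andP; split.
- have := @coh _ _ _ _ DX DZ 1 1 ler01.
  set S := [set _ | _]; set G := fun _ => _ => /= GS.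
  have S0 : S !=set0 by exists b; right; rewrite oner_neq0.
  apply: (sup_ge0_cst S0 _ (GS S0)) => w Sw.
  have Bw : B w by case: Sw => -[] // _ [].
  rewrite /G !indicE in_setI (mem_set Bw) andbT /=; ring.
- have := @coh _ _ _ _ DZ DX 1 1 ler01.
  set S := [set _ | _]; set G := fun _ => _ => /= GS.
  have S0 : S !=set0 by exists b; left; rewrite oner_neq0.
  apply: (sup_ge0_cst S0 _ (GS S0)) => w Sw.
  have Bw : B w by case: Sw => -[] // _ [].
  rewrite /G !indicE in_setI (mem_set Bw) andbT /=; ring.
Qed.

End necessity.

(** * Sufficiency: the axioms exclude a uniform loss *)

Section sufficiency.
Hypothesis le_sup : forall (X Y : T -> R) (B : set T),
  D (cond X B) -> D (cond Y B) ->
  P (cond X B) - P (cond Y B) <= sup ((X \- Y) @` B).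
Hypothesis scale_eq : forall (X : T -> R) (B : set T) (l : R),
  D (cond X B) -> 0 <= l -> P (cond (l *: X) B) = l * P (cond X B).
Hypothesis gain0 : forall (X : T -> R) (A B : set T),
  L X -> nonempty_events EB A -> nonempty_events EB B -> A `&` B !=set0 ->
  P (cond (gain X A (P (cond X (A `&` B)))) B) = 0.
Hypothesis scale_le : forall (X : T -> R) (B : set T) (l : R),
  D (cond X B) -> l < 0 -> P (cond (l *: X) B) <= l * P (cond X B).

(** (A1) freed of the supremum: a uniform gap on [B] passes to the previsions. *)
Lemma prevision_le (X Y : T -> R) (B : set T) (e : R) :
  L X -> L Y -> nonempty_events EB B ->
  (forall w, B w -> X w + e <= Y w) -> P (cond X B) + e <= P (cond Y B).
Proof.
move=> LX LY EB_B XY.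
have := le_sup (D_LIN_cond LX EB_B) (D_LIN_cond LY EB_B).
have : sup ((X \- Y) @` B) <= - e.
  apply: sup_le_ub.
    case/nonempty_eventsP: EB_B => _ [w Bw].
    by exists ((X \- Y) w), w.
  move=> _ [w Bw <-] /=; have := XY w Bw; lra.
lra.
Qed.

Lemma prevision0 (B : set T) : nonempty_events EB B -> P (cond 0 B) = 0.
Proof.
move=> EB_B.
have L0 : L 0 by case: L_linear => L0 _; exact: set_mem.
by rewrite -(scale0r 0) (scale_eq (D_LIN_cond L0 EB_B)) ?mul0r.
Qed.

(** If [m = P(Z|C /\ A)] were negative, then [C (Z - m)] would exceed [Z] on [A] by at least
    [min(e, -m)]: by [-m] inside [C], and by [e] outside, where it vanishes. Its prevision given [A]
    would be positive, against (A4). *)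
Lemma prevision_ge0_cap (Z : T -> R) (A C : set T) (e : R) :
  L Z -> nonempty_events EB A -> nonempty_events EB C -> C `&` A !=set0 ->
  0 < e -> (forall w, A w -> ~ C w -> Z w <= - e) -> 0 <= P (cond Z A) ->
  0 <= P (cond Z (C `&` A)).
Proof.
move=> LZ EB_A EB_C CA e0 Ze ZA; rewrite leNgt; apply/negP => m0.
have W0 := gain0 LZ EB_C EB_A CA.
set m := P (cond Z (C `&` A)) in m0 W0.
pose d := Num.min e (- m).
have d0 : 0 < d by rewrite lt_min e0 oppr_gt0.
have LW : L (gain Z C m) by apply: gain_mem => //; case: EB_C.
have : P (cond Z A) + d <= P (cond (gain Z C m) A).
  apply: prevision_le => // w Aw.
  have de : d <= e by rewrite ge_min lexx.
  have dm : d <= - m by rewrite ge_min lexx orbT.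
  rewrite /= indicE; have [Cw|nCw] := pselect (C w).
    rewrite mem_set //=; lra.
  rewrite memNset //=; have := Ze w Aw nCw; lra.
rewrite W0; lra.
Qed.

(** Needs its own proof: (A6) bounds [P(-Z|A)] only from above, so the previous lemma does not apply
    to [-Z]. *)
Lemma prevision_le0_cap (Z : T -> R) (A C : set T) (e : R) :
  L Z -> nonempty_events EB A -> nonempty_events EB C -> C `&` A !=set0 ->
  0 < e -> (forall w, A w -> ~ C w -> e <= Z w) -> P (cond Z A) <= 0 ->
  P (cond Z (C `&` A)) <= 0.
Proof.
move=> LZ EB_A EB_C CA e0 Ze ZA; rewrite leNgt; apply/negP => m0.
have W0 := gain0 LZ EB_C EB_A CA.
set m := P (cond Z (C `&` A)) in m0 W0.
pose d := Num.min e m.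
have d0 : 0 < d by rewrite lt_min e0.
have LW : L (gain Z C m) by apply: gain_mem => //; case: EB_C.
have : P (cond (gain Z C m) A) + d <= P (cond Z A).
  apply: prevision_le => // w Aw.
  have de : d <= e by rewrite ge_min lexx.
  have dm : d <= m by rewrite ge_min lexx orbT.
  rewrite /= indicE; have [Cw|nCw] := pselect (C w).
    rewrite mem_set //=; lra.
  rewrite memNset //=; have := Ze w Aw nCw; lra.
rewrite W0; lra.
Qed.

Lemma prevision_scaled_gain (X : T -> R) (B : set T) (s : R) :
  L X -> nonempty_events EB B -> 0 <= s ->
  P (cond (s *: gain X B (P (cond X B))) B) = 0.
Proof.
move=> LX EB_B s0.
have B0 : B `&` B !=set0 by rewrite setIid; case/nonempty_eventsP: EB_B.
rewrite scale_eq //; last first.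
  by apply: D_LIN_cond => //; apply: gain_mem => //; case: EB_B.
by have := gain0 LX EB_B EB_B B0; rewrite setIid => ->; rewrite mulr0.
Qed.

Lemma no_sure_loss (X0 X1 : T -> R) (B0 B1 : set T) (s0 s1 e : R) :
  L X0 -> L X1 -> nonempty_events EB B0 -> nonempty_events EB B1 ->
  0 <= s1 -> 0 < e -> s0 != 0 \/ s1 != 0 ->
  ~ (forall w, (s0 != 0 /\ B0 w) \/ (s1 != 0 /\ B1 w) ->
     s1 * gain X1 B1 (P (cond X1 B1)) w
       - s0 * gain X0 B0 (P (cond X0 B0)) w <= - e).
Proof.
move=> LX0 LX1 EB0 EB1 s1_ge0 e0 s_neq0.
have := prevision_scaled_gain LX1 EB1 s1_ge0.
(* (A2) covers nonnegative factors only, hence [|s0|]; the sign of [s0] is treated by cases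
   below. *)
have := prevision_scaled_gain LX0 EB0 (normr_ge0 s0).
have U0out w : ~ B0 w -> gain X0 B0 (P (cond X0 B0)) w = 0.
  by move=> ?; rewrite /= indicE memNset //= mul0r.
have U1out w : ~ B1 w -> gain X1 B1 (P (cond X1 B1)) w = 0.
  by move=> ?; rewrite /= indicE memNset //= mul0r.
have LU0 : L (gain X0 B0 (P (cond X0 B0))) by apply: gain_mem; case: EB0.
have LU1 : L (gain X1 B1 (P (cond X1 B1))) by apply: gain_mem; case: EB1.
(* From here on, all that matters of the gains is that they lie in [L], vanish off their events and
   have prevision 0 after scaling. *)
move: (gain X0 _ _) (gain X1 _ _) U0out U1out LU0 LU1.
move=> U0 U1 U0out U1out LU0 LU1 PU0 PU1 loss.
have L0 : L 0 by case: L_linear => L0 _; exact: set_mem.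
have LZ0 : L (`|s0| *: U0) by exact: submodZ.
have LZ1 : L (s1 *: U1) by exact: submodZ.
have Z0E w : (`|s0| *: U0) w = `|s0| * U0 w by [].
have Z1E w : (s1 *: U1) w = s1 * U1 w by [].
(* With [s1 = 0] only the bet on [B0] remains; it is compared with the zero gamble, from above or
   below according to the sign of [s0]. *)
have [s10|s1_neq0] := eqVneq s1 0.
  have s0_neq0 : s0 != 0 by case: s_neq0; rewrite // s10 eqxx.
  have loss0 w : B0 w -> - (s0 * U0 w) <= - e.
    move=> Bw; have := loss w (or_introl (conj s0_neq0 Bw)).
    rewrite s10; lra.
  have [s0_ge0|s0_lt0] := leP 0 s0.
    suff : P (cond 0 B0) + e <= P (cond (`|s0| *: U0) B0).
      rewrite PU0 prevision0 //; lra.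
    apply: prevision_le => // w Bw; have := loss0 w Bw.
    rewrite Z0E ger0_norm // (_ : (0 : T -> R) w = 0) //; lra.
  suff : P (cond (`|s0| *: U0) B0) + e <= P (cond 0 B0).
    rewrite PU0 prevision0 //; lra.
  apply: prevision_le => // w Bw; have := loss0 w Bw.
  rewrite Z0E ltr0_norm // (_ : (0 : T -> R) w = 0) //; lra.
have loss1 w : B1 w -> s1 * U1 w - s0 * U0 w <= - e.
  by move=> Bw; apply: loss; right.
(* If [s0 = 0] or the events are disjoint, [s0 U0] vanishes on [B1], so [s1 U1 <= -e] there although
   its prevision is 0. *)
have [[s0_neq0 B01]|indep] := pselect (s0 != 0 /\ B0 `&` B1 !=set0); last first.
  suff : P (cond (s1 *: U1) B1) + e <= P (cond 0 B1).
    rewrite PU1 prevision0 //; lra.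
  apply: prevision_le => // w Bw; have := loss1 w Bw.
  suff -> : s0 * U0 w = 0 by rewrite Z1E (_ : (0 : T -> R) w = 0) //; lra.
  have [->|s0_neq0] := eqVneq s0 0; first by rewrite mul0r.
  by rewrite U0out ?mulr0 // => B0w; apply: indep; split=> //; exists w.
have loss0 w : B0 w -> s1 * U1 w - s0 * U0 w <= - e.
  by move=> Bw; apply: loss; left.
have B10 : B1 `&` B0 !=set0 by rewrite setIC.
have EB01 : nonempty_events EB (B0 `&` B1).
  apply/nonempty_eventsP; split=> //.
  by case: EB0 EB1 => [EB0 _] [EB1 _]; exact: EB_cap.
(* Outside [B0] the loss on [B1] is carried by [s1 U1] alone. *)
have m1 : 0 <= P (cond (s1 *: U1) (B0 `&` B1)).
  apply: (prevision_ge0_cap (e := e)); rewrite ?PU1 // => w Bw nB0w.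
  by have := loss1 w Bw; rewrite U0out // Z1E mulr0 subr0.
have [s0_gt0|s0_lt0|s00] := ltgtP 0 s0; last by rewrite -s00 eqxx in s0_neq0.
  (* For [s0 > 0], [s0 U0 >= e] on [B0] outside [B1]; on the intersection [s1 U1 + e <= s0 U0],
     which is incompatible with the signs of the two previsions. *)
  have m0 : P (cond (`|s0| *: U0) (B0 `&` B1)) <= 0.
    rewrite setIC; apply: (prevision_le0_cap (e := e)); rewrite ?PU0 //.
    move=> w Bw nB1w; have := loss0 w Bw.
    rewrite U1out // Z0E gtr0_norm // mulr0; lra.
  have : P (cond (s1 *: U1) (B0 `&` B1)) + e
         <= P (cond (`|s0| *: U0) (B0 `&` B1)).
    apply: prevision_le => // w [_ Bw]; have := loss1 w Bw.
    rewrite Z0E Z1E gtr0_norm //; lra.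
  lra.
(* For [s0 < 0] both previsions on the intersection are nonnegative. (A6) with factor -1 gives
   [P(-|s0| U0) <= 0], while [s1 U1 + e <= -|s0| U0] there. *)
have m0 : 0 <= P (cond (`|s0| *: U0) (B0 `&` B1)).
  rewrite setIC; apply: (prevision_ge0_cap (e := e)); rewrite ?PU0 //.
  move=> w Bw nB1w; have := loss0 w Bw.
  rewrite U1out // Z0E ltr0_norm // mulr0; lra.
have := scale_le (D_LIN_cond LZ0 EB01) (ltrN10 R).
have : P (cond (s1 *: U1) (B0 `&` B1)) + e
       <= P (cond (- 1 *: (`|s0| *: U0)) (B0 `&` B1)).
  apply: prevision_le; rewrite //; first exact: submodZ.
  move=> w [_ Bw]; have := loss1 w Bw.
  rewrite (_ : (- 1 *: (`|s0| *: U0)) w = - 1 * (`|s0| * U0 w)) // Z1E.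
  rewrite ltr0_norm //; lra.
lra.
Qed.

End sufficiency.
End coherence.

(** * The equivalence, by passing to representatives in [L] *)

Theorem proposition9 (T : Type) (R : realType)
  (L : set (T -> R)) (EB : set (set T))
  (L_gamble : forall X, L X -> bounded_fun X)
  (L_linear : GRing.submod_closed (mem L))
  (EB_sub : forall B, EB B -> L (\1_B))
  (EB_T : EB setT)
  (EB_mul : forall B X, EB B -> L X -> L (\1_B \* X))
  (EB_cap : forall A B, EB A -> EB B -> A `&` B !=set0 -> EB (A `&` B))
  (P : cgamble T R -> R) :
  two_coherent (D_LIN L EB) P <->
  [/\ forall (X Y : T -> R) (B : set T),
        D_LIN L EB (cond X B) -> D_LIN L EB (cond Y B) ->
        P (cond X B) - P (cond Y B) <= sup ((X \- Y) @` B),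
      forall (X : T -> R) (B : set T) (l : R),
        D_LIN L EB (cond X B) -> 0 <= l ->
        P (cond (l *: X) B) = l * P (cond X B),
      forall (X : T -> R) (A B : set T),
        L X -> nonempty_events EB A -> nonempty_events EB B ->
        A `&` B !=set0 ->
        P (cond (\1_A \* (X \- cst (P (cond X (A `&` B))))) B) = 0
    & forall (X : T -> R) (B : set T) (l : R),
        D_LIN L EB (cond X B) -> l < 0 ->
        P (cond (l *: X) B) <= l * P (cond X B)].
Proof.
(* Boundedness of the gambles in [L] makes the suprema genuine rather than default values. *)
have L_sup X Y a b (A : set T) : L X -> L Y -> A !=set0 ->
    has_sup ((fun w => a * X w + b * Y w) @` A).
  move=> LX LY [w Aw]; split; first by exists (a * X w + b * Y w), w.
  have LXY : L (a *: X + b *: Y) by apply: submodD => //; exact: submodZ.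
  have [M XYM] := bounded_fun_has_ubound (L_gamble _ LXY).
  by exists M => _ [v Av <-]; apply: XYM; exists v.
have D_scale X B l : D_LIN L EB (cond X B) -> D_LIN L EB (cond (l *: X) B).
  move=> /D_LINP [EB_B [Y LY XY]].
  rewrite (_ : cond (l *: X) B = cond (l *: Y) B).
    by apply: D_LIN_cond => //; exact: submodZ.
  by apply: eq_cond => w Bw; congr (l * _); exact: XY.
have D_neq0 X B : D_LIN L EB (cond X B) -> B !=set0.
  by move=> /D_LINP [/nonempty_eventsP []].
have gain_L X B c : L X -> nonempty_events EB B -> L (\1_B \* (X \- cst c)).
  by move=> LX [EB_B _]; exact: (gain_mem L_linear EB_sub EB_mul).
split=> [coh|[le_sup scale_eq gain0 scale_le]].
  split.
  - move=> X Y B DX DY; have B0 := D_neq0 _ _ DX.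
    apply: (coherent_le_sup coh) => //.
    (* [X] and [Y] need not lie in [L], so boundedness on [B] is read off their representatives. *)
    have [_ [X' LX' XX']] := D_LINP DX; have [_ [Y' LY' YY']] := D_LINP DY.
    rewrite (_ : _ @` B = (fun w => 1 * X' w + (- 1) * Y' w) @` B).
      exact: L_sup.
    by apply: eq_imagel => w Bw /=; rewrite XX' // YY' // mul1r mulN1r.
  - move=> X B l DX l0; have B0 := D_neq0 _ _ DX; apply/eqP.
    by rewrite eq_le (coherent_scale_le coh) ?(coherent_scale_ge coh) //;
      exact: D_scale.
  - move=> X A B LX EB_A EB_B AB.
    have EB_AB : nonempty_events EB (A `&` B).
      apply/nonempty_eventsP; split=> //.
      by case: EB_A EB_B => [EB_A _] [EB_B _]; exact: EB_cap.
    have B0 : B !=set0 by case/nonempty_eventsP: EB_B.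
    apply: (coherent_gain0 coh) => //; first exact: D_LIN_cond.
    by apply: D_LIN_cond => //; exact: gain_L.
  - move=> X B l DX _; have B0 := D_neq0 _ _ DX.
    by apply: (coherent_scale_le coh) => //; exact: D_scale.
move=> X0 X1 B0 B1 /D_LINP [EB0 [Y0 LY0 XY0]] /D_LINP [EB1 [Y1 LY1 XY1]].
move=> s0 s1 s1_ge0 S G S0.
rewrite /G (eq_cond XY0) (eq_cond XY1).
pose c0 := P (cond Y0 B0); pose c1 := P (cond Y1 B1).
pose U0 := \1_B0 \* (Y0 \- cst c0); pose U1 := \1_B1 \* (Y1 \- cst c1).
have LU0 : L U0 by exact: gain_L.
have LU1 : L U1 by exact: gain_L.
(* The indicator removes the values off [B], so the representative gives the same gain on the whole
   space. *)
have UE (X Y : T -> R) (B : set T) s c w : (forall w, B w -> X w = Y w) ->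
    s * \1_B w * (X w - c) = s * (\1_B \* (Y \- cst c)) w.
  move=> XY; rewrite /= indicE; have [Bw|nBw] := pselect (B w).
    by rewrite mem_set //= XY //; ring.
  by rewrite memNset //=; ring.
have -> : [set s1 * \1_B1 w * (X1 w - c1) - s0 * \1_B0 w * (X0 w - c0)
          | w in S] = [set s1 * U1 w + (- s0) * U0 w | w in S].
  by apply: eq_imagel => w _; rewrite (UE _ _ _ _ _ _ XY0) (UE _ _ _ _ _ _ XY1)
    mulNr.
rewrite leNgt; apply/negP => sup_lt0.
have [_ Ssup] := L_sup U1 U0 s1 (- s0) S LU1 LU0 S0.
(* A negative supremum is itself a uniform bound on the gain over [S], so its opposite serves as
   [e]. *)
apply: (no_sure_loss L_linear EB_sub EB_mul EB_cap le_sup scale_eq gain0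
  scale_le (s0 := s0) (e := - sup [set s1 * U1 w + (- s0) * U0 w | w in S])
  LY0 LY1 EB0 EB1 s1_ge0).
- by rewrite oppr_gt0.
- by case: S0 => w [] [s_neq0 _]; [left|right].
- move=> w Sw; rewrite opprK -mulNr.
  by apply: ub_le_sup => //; exists w.
Qed.
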